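(* Let $n\ge 0$ and $0\leq k,l\leq n$. The $\Bbbk[IS_n]$-module $\Bbbk[\mathbf{L}_k]\otimes_\Bbbk\Bbbk[\mathbf{L}_l]$ has a filtration whose subquotients are isomorphic to cell modules (that is, to modules $\Bbbk[\mathbf{L}_r]$ with $0\le r\le n$). Moreover, for each $m\le n$ with $\max\{k,l\}\leq m\leq k+l$, the multiplicity of $\Bbbk[\mathbf{L}_m]$ in $\Bbbk[\mathbf{L}_k]\otimes_\Bbbk\Bbbk[\mathbf{L}_l]$ (the number of subquotients isomorphic to $\Bbbk[\mathbf{L}_m]$ in such a filtration) equals $$\frac{(a+b)!\,(b+c)!}{a!\,b!\,c!},\qquad\text{where } b:=k+l-m,\ a:=k-b,\ c:=l-b.$$
   Context: $\Bbbk$ is an algebraically closed field of characteristic zero; $\underline{n}=\{1,\dots,n\}$. $IS_n$ is the symmetric inverse semigroup: all bijections between subsets of $\underline{n}$, under composition (right to left) of partially defined maps. For $0\le r\le n$, let $\mathbf{L}_r$ be the set of all $\sigma\in IS_n$ with domain $\underline{r}$ (the left cell, i.e. $\mathcal{L}$-class, containing the identity on $\underline{r}$). The cell module $\Bbbk[\mathbf{L}_r]$ has basis $\mathbf{L}_r$ and action, for $\sigma\in IS_n$, $\pi\in\mathbf{L}_r$: $\sigma\cdot\pi=\sigma\pi$ if $\sigma\pi\in\mathbf{L}_r$, and $\sigma\cdot\pi=0$ otherwise. Up to isomorphism every cell module (for an arbitrary left cell) is one of the $\Bbbk[\mathbf{L}_r]$. The tensor product over $\Bbbk$ of two $\Bbbk[IS_n]$-modules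 is a $\Bbbk[IS_n]$-module via the diagonal action $\sigma\mapsto\sigma\otimes\sigma$. The multiplicity of a cell module in a filtration with cell subquotients does not depend on the filtration, because $\Bbbk[IS_n]$ is semisimple and non-isomorphic cell modules have no common non-zero simple summands. *)

(* Defs.v *)
From HB Require Import structures.
From mathcomp Require Import all_boot all_order all_algebra.
From mathcomp Require Import generic_quotient ring_quotient.
From mathcomp Require Import boolp.

Set Implicit Arguments.
Unset Strict Implicit.
Unset Printing Implicit Defensive.

Import GRing.Theory passmx.
Local Open Scope ring_scope.
Local Open Scope quotient_scope.

(** * The symmetric inverse semigroup *)

(* The set {1, ..., n} is modelled by 'I_n = {0, ..., n-1}; a partial self-map
   is an option-valued function, [None] meaning "undefined". *)
Definition partial_inj n (f : {ffun 'I_n -> option 'I_n}) : bool :=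
  [forall x, forall y, (f x != None) && (f x == f y) ==> (x == y)].

Record ISn (n : nat) := PartialInj {
  pfun :> {ffun 'I_n -> option 'I_n};
  pfunP : partial_inj pfun
}.

HB.instance Definition _ n := [isSub for @pfun n].
HB.instance Definition _ n := [Finite of ISn n by <:].

Section ISn.
Variable n : nat.
Implicit Types s t u : ISn n.

Lemma partial_injP (f : {ffun 'I_n -> option 'I_n}) :
  reflect (forall x y, f x != None -> f x = f y -> x = y) (partial_inj f).
Proof.
apply: (iffP forallP) => [fP x y fx fxy|fP x].
  by apply/eqP; move/forallP/(_ y): (fP x); rewrite fx fxy eqxx.
by apply/forallP=> y; apply/implyP=> /andP[fx /eqP fxy]; apply/eqP/fP.
Qed.

Lemma pfun_inj s x y : s x != None -> s x = s y -> x = y.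
Proof. by move: (pfunP s) => /partial_injP; apply. Qed.

Lemma ISn_ext s t : s =1 t -> s = t.
Proof. by move=> st; apply/val_inj/ffunP. Qed.

Fact ISn_one_subproof : partial_inj [ffun x : 'I_n => Some x].
Proof. by apply/partial_injP=> x y; rewrite !ffunE => _ []. Qed.
Definition ISn_one : ISn n := PartialInj ISn_one_subproof.

(* Composition is from right to left. *)
Fact ISn_mul_subproof s t : partial_inj [ffun x : 'I_n => obind s (t x)].
Proof.
apply/partial_injP=> x y; rewrite !ffunE.
case tx: (t x) => [a|] //=; case ty: (t y) => [b|] /= sa sab.
  have ab := pfun_inj sa sab.
  by apply: (@pfun_inj t); rewrite tx // ty ab.
by rewrite sab in sa.
Qed.
Definition ISn_mul s t : ISn n := PartialInj (ISn_mul_subproof s t).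

Fact ISn_mulA : associative ISn_mul.
Proof.
move=> s t u; apply: ISn_ext => x; rewrite !ffunE.
by case: (u x) => //= a; rewrite ffunE.
Qed.

Fact ISn_mul1 : left_id ISn_one ISn_mul.
Proof.
move=> s; apply: ISn_ext => x; rewrite ffunE.
by case: (s x) => //= a; rewrite ffunE.
Qed.

Fact ISn_1mul : right_id ISn_one ISn_mul.
Proof. by move=> s; apply: ISn_ext => x; rewrite !ffunE. Qed.

HB.instance Definition _ := isMonoid.Build (ISn n) ISn_mulA ISn_mul1 ISn_1mul.

Definition pdom s : {set 'I_n} := [set x | s x != None].

End ISn.

(** * Finite-dimensional modules over a monoid algebra *)

(* A K[M]-module is a K-space on which M acts by a homomorphism of monoids
   to the (multiplicative) monoid of linear endomorphisms. *)
Record module (K : fieldType) (M : monoidType) := Module {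
  mspace :> vectType K;
  mact : M -> 'End(mspace);
  _ : mact 1%g = \1%VF;
  _ : forall s t, mact (s * t)%g = (mact s \o mact t)%VF
}.
Arguments mact {K M} V s : rename.

Section ModuleTheory.
Variables (K : fieldType) (M : monoidType).
Implicit Types V W : module K M.

Lemma mact1 V v : mact V 1%g v = v.
Proof. by case: V v => V r r1 rM v /=; rewrite r1 id_lfunE. Qed.

Lemma mactM V s t v : mact V (s * t)%g v = mact V s (mact V t v).
Proof. by case: V v => V r r1 rM v /=; rewrite rM comp_lfunE. Qed.

Definition isomorphic V W : Prop :=
  exists f : 'Hom(V, W),
    bijective f /\ forall s v, f (mact V s v) = mact W s (f v).

Record submodule V := Submodule {
  subspace_of :> {vspace V};
  submoduleP : forall s v, v \in subspace_of -> mact V s v \in subspace_of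
}.

End ModuleTheory.

(** * Submodules and quotients as modules *)

Section SubModule.
Variables (K : fieldType) (M : monoidType) (V : module K M) (U : submodule V).

Definition sub_act_fun s (u : subvs_of U) : subvs_of U :=
  Subvs (submoduleP s (subvsP u)).

Fact sub_act_is_linear s : linear (sub_act_fun s).
Proof. by move=> a u v; apply: val_inj; rewrite /= linearP. Qed.
HB.instance Definition _ s :=
  GRing.isLinear.Build K (subvs_of U) (subvs_of U) _ _ (sub_act_is_linear s).

Definition sub_act s : 'End(subvs_of U) := linfun (sub_act_fun s).

Lemma sub_actE s u : vsval (sub_act s u) = mact V s (vsval u).
Proof. by rewrite lfunE. Qed.

Fact sub_act1 : sub_act 1%g = \1%VF.
Proof.
by apply/lfunP=> u; apply: val_inj; rewrite /= sub_actE mact1 id_lfunE.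
Qed.

Fact sub_actM s t : sub_act (s * t)%g = (sub_act s \o sub_act t)%VF.
Proof.
by apply/lfunP=> u; apply: val_inj; rewrite /= comp_lfunE !sub_actE mactM.
Qed.

Definition sub_module : module K M := Module sub_act1 sub_actM.

End SubModule.

Section QuotientSpace.
Variables (K : fieldType) (V : vectType K) (U : {vspace V}).

Definition quotv : Type := Quotient.quot (pred_of_vspace U).

HB.instance Definition _ := GRing.Zmodule.on quotv.
HB.instance Definition _ := EqQuotient.on quotv.

Definition proj_quotv (v : V) : quotv := \pi_(quotv) v.

Lemma proj_quotv_eq (v w : V) :
  (proj_quotv v == proj_quotv w) = (v - w \in U).
Proof. by rewrite [RHS]Quotient.idealrBE. Qed.

Lemma proj_reprK : cancel (@repr _ quotv) proj_quotv.
Proof. by move=> x; rewrite /proj_quotv reprK. Qed.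

Lemma repr_proj_quotv (v : V) : repr (proj_quotv v) - v \in U.
Proof. by rewrite -proj_quotv_eq proj_reprK. Qed.

Lemma proj_quotvD : {morph proj_quotv : v w / v + w}.
Proof. by move=> v w; exact: (@Quotient.pi_add _ (pred_of_vspace U)). Qed.

Definition scale_quotv (a : K) (x : quotv) : quotv := proj_quotv (a *: repr x).

Lemma scale_quotvE a v : scale_quotv a (proj_quotv v) = proj_quotv (a *: v).
Proof.
by apply/eqP; rewrite proj_quotv_eq -scalerBr rpredZ ?repr_proj_quotv.
Qed.

Fact scale_quotvA a b x :
  scale_quotv a (scale_quotv b x) = scale_quotv (a * b) x.
Proof. by rewrite -[x]proj_reprK !scale_quotvE scalerA. Qed.

Fact scale_quotv1 : left_id 1 scale_quotv.
Proof. by move=> x; rewrite -[x]proj_reprK scale_quotvE scale1r. Qed.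

Fact scale_quotvDr : right_distributive scale_quotv +%R.
Proof.
move=> a x y; rewrite -[x]proj_reprK -[y]proj_reprK -proj_quotvD !scale_quotvE.
by rewrite scalerDr proj_quotvD.
Qed.

Fact scale_quotvDl x : {morph scale_quotv^~ x : a b / a + b}.
Proof.
by move=> a b; rewrite -[x]proj_reprK !scale_quotvE scalerDl proj_quotvD.
Qed.

HB.instance Definition _ := GRing.Zmodule_isLmodule.Build K quotv
  scale_quotvA scale_quotv1 scale_quotvDr scale_quotvDl.

Fact proj_quotv_is_linear : linear proj_quotv.
Proof. by move=> a v w; rewrite proj_quotvD -scale_quotvE. Qed.
HB.instance Definition _ :=
  GRing.isLinear.Build K V quotv _ _ proj_quotv_is_linear.

Fact quotv_vect_iso : Vector.axiom (\dim {: subvs_of U^C}) quotv.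
Proof.
pose p v : subvs_of U^C := vsproj U^C (v - projv U v).
have p_lin : linear p.
  move=> a v w; rewrite /p -linearP; congr (vsproj _ _).
  by rewrite linearP scalerBr opprD addrACA.
have pE v w : v - w \in U -> p v = p w.
  move=> vwU; congr (vsproj _ _); apply/eqP; rewrite -subr_eq0.
  rewrite [X in X == 0](_ : _ = (v - w) - projv U (v - w)).
    by rewrite projv_id // subrr.
  by rewrite [projv U (v - w)]linearB !opprD addrACA.
pose e := vbasis {: subvs_of U^C}.
pose f (x : quotv) := rVof e (p (repr x)).
have fE v : f (proj_quotv v) = rVof e (p v).
  by congr (rVof _ _); apply/pE/repr_proj_quotv.
exists f.
  move=> a x y; rewrite -[x]proj_reprK -[y]proj_reprK -linearP !fE.
  by rewrite -linearP -p_lin.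
exists (fun r => proj_quotv (vsval (vecof e r))) => [x|r].
  rewrite -[x in LHS]proj_reprK fE (rVofK (vbasisP _)) /p.
  rewrite vsprojK ?memv_projC //.
  rewrite -[RHS]proj_reprK; apply/eqP; rewrite proj_quotv_eq addrAC subrr sub0r.
  by rewrite rpredN memv_proj.
rewrite fE -[RHS](vecofK (vbasisP _)); congr (rVof _ _); apply: val_inj.
rewrite /= vsprojK ?memv_projC //.
set u := vsval _; have : u \in U^C%VS by exact: subvsP.
by rewrite -lker_proj memv_ker => /eqP ->; rewrite subr0.
Qed.

HB.instance Definition _ := Lmodule_hasFinDim.Build K quotv quotv_vect_iso.

End QuotientSpace.

Section QuotientModule.
Variables (K : fieldType) (M : monoidType) (V : module K M) (U : submodule V).

Definition quot_act_fun s (x : quotv U) : quotv U :=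
  proj_quotv U (mact V s (repr x)).

Lemma quot_act_funE s v :
  quot_act_fun s (proj_quotv U v) = proj_quotv U (mact V s v).
Proof.
apply/eqP; rewrite proj_quotv_eq -linearB submoduleP //.
exact: repr_proj_quotv.
Qed.

Fact quot_act_is_linear s : linear (quot_act_fun s).
Proof.
move=> a x y; rewrite -[x]proj_reprK -[y]proj_reprK -linearP !quot_act_funE.
by rewrite !linearP.
Qed.
HB.instance Definition _ s :=
  GRing.isLinear.Build K (quotv U) (quotv U) _ _ (quot_act_is_linear s).

Definition quot_act s : 'End(quotv U) := linfun (quot_act_fun s).

Lemma quot_actE s v :
  quot_act s (proj_quotv U v) = proj_quotv U (mact V s v).
Proof. by rewrite lfunE /= quot_act_funE. Qed.

Fact quot_act1 : quot_act 1%g = \1%VF.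
Proof.
by apply/lfunP=> x; rewrite -[x]proj_reprK quot_actE mact1 id_lfunE.
Qed.

Fact quot_actM s t : quot_act (s * t)%g = (quot_act s \o quot_act t)%VF.
Proof.
apply/lfunP=> x; rewrite -[x]proj_reprK comp_lfunE !quot_actE.
by rewrite mactM.
Qed.

Definition quot_module : module K M := Module quot_act1 quot_actM.

End QuotientModule.

Section Subquotient.
Variables (K : fieldType) (M : monoidType) (V : module K M).
Implicit Types E F : submodule V.

Definition trace_space E F : {vspace sub_module E} :=
  (linfun (vsval : subvs_of E -> V) @^-1: F)%VS.

Lemma trace_spaceE E F (u : subvs_of E) :
  (u \in trace_space E F) = (vsval u \in F).
Proof. by rewrite -memv_preim lfunE. Qed.

Fact trace_spaceP E F s u :
  u \in trace_space E F -> mact (sub_module E) s u \in trace_space E F.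
Proof. by rewrite !trace_spaceE => uF; rewrite sub_actE submoduleP. Qed.

(* The module E / (E :&: F), that is E / F when F is contained in E. *)
Definition subquotient E F : module K M :=
  quot_module (Submodule (@trace_spaceP E F)).

(* 0 = F_0 <= F_1 <= ... <= F_t = V, with t = [flength]; the values of the
   sequence beyond t are irrelevant. *)
Record filtration := Filtration {
  flength : nat;
  fterm :> nat -> submodule V;
  _ : fterm 0%N = 0%VS :> {vspace V};
  _ : forall i, (i < flength)%N -> (fterm i <= fterm i.+1)%VS;
  _ : fterm flength = fullv :> {vspace V}
}.

Definition multiplicity (F : filtration) (W : module K M) : nat :=
  #|[set i : 'I_(flength F) |
      `[< isomorphic (subquotient (F i.+1) (F i)) W >]]|.

End Subquotient.

(** * Tensor products *)

Section Tensor.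
Variables (K : fieldType).

Local Notation e V := (vbasis {: V}).

(* In terms of the coordinates with respect to chosen bases of V and W, the
   space V (x) W is the space of matrices and v (x) w is the rank-one matrix
   (v_i w_j)_(i, j); [tens_univ] is its universal property. *)
Definition tensor (V W : vectType K) : vectType K :=
  'M[K]_(\dim {: V}, \dim {: W}).

Definition tens (V W : vectType K) (v : V) (w : W) : tensor V W :=
  (rVof (e V) v)^T *m rVof (e W) w.

Lemma tensDl (V W : vectType K) a (v v' : V) (w : W) :
  tens (a *: v + v') w = a *: tens v w + tens v' w.
Proof. by rewrite /tens !linearP mulmxDl -scalemxAl. Qed.

Lemma tensDr (V W : vectType K) a (v : V) (w w' : W) :
  tens v (a *: w + w') = a *: tens v w + tens v w'.
Proof. by rewrite /tens !linearP. Qed.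

Lemma tensE (V W : vectType K) (A : tensor V W) :
  A = \sum_i \sum_j A i j *: tens (e V)`_i (e W)`_j.
Proof.
rewrite [LHS]matrix_sum_delta; apply: eq_bigr => i _; apply: eq_bigr => j _.
by rewrite /tens !rVofE ?vbasisP // trmx_delta mul_delta_mx.
Qed.

Lemma tens_univ (V W : vectType K) (T : lmodType K) (b : V -> W -> T) :
    (forall w, linear (b^~ w)) -> (forall v, linear (b v)) ->
  exists2 f : tensor V W -> T, linear f & (forall v w, f (tens v w) = b v w) /\
    (forall g : tensor V W -> T, linear g ->
      (forall v w, g (tens v w) = b v w) -> g =1 f).
Proof.
move=> bl br.
pose f (A : tensor V W) :=
  \sum_i \sum_j A i j *: b (e V)`_i (e W)`_j.
have lsum (X : lmodType K) (g : X -> T) (I : finType)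
    (c : I -> K) (x : I -> X) :
    linear g -> g (\sum_i c i *: x i) = \sum_i c i *: g (x i).
  move=> glin; pose gL : {linear X -> T} :=
    HB.pack g (GRing.isLinear.Build K X T _ g glin).
  rewrite -[g]/(gL : X -> T) linear_sum; apply: eq_bigr => i _.
  by rewrite linearZ.
exists f; last split.
- move=> a A B; rewrite /f scaler_sumr -big_split; apply: eq_bigr => i _.
  rewrite scaler_sumr -big_split; apply: eq_bigr => j _.
  by rewrite /= !mxE scalerDl scalerA.
- move=> v w; rewrite -[v in RHS](rVofK (vbasisP _)).
  rewrite -[w in RHS](rVofK (vbasisP _)).
  rewrite (lsum _ (b^~ _)) //; apply: eq_bigr => i _.
  rewrite (lsum _ (b _)) // scaler_sumr; apply: eq_bigr => j _.
  by rewrite scalerA /tens mxE big_ord1 mxE.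
- move=> g glin gE A; rewrite {1}[A]tensE.
  have glin0 (I : finType) (B : I -> tensor V W) :
      g (\sum_i B i) = \sum_i g (B i).
    have := lsum _ g I (fun=> 1) B glin.
    under eq_bigr do rewrite scale1r.
    by move=> ->; under eq_bigr do rewrite scale1r.
  rewrite glin0; apply: eq_bigr => i _.
  by rewrite (lsum _ g) //; apply: eq_bigr => j _; rewrite gE.
Qed.

Definition tensor_hom_fun (V W V' W' : vectType K)
    (f : 'Hom(V, V')) (g : 'Hom(W, W')) (A : tensor V W) : tensor V' W' :=
  (mxof (e V) (e V') f)^T *m A *m mxof (e W) (e W') g.

Fact tensor_hom_is_linear (V W V' W' : vectType K)
  (f : 'Hom(V, V')) (g : 'Hom(W, W')) : linear (tensor_hom_fun f g).
Proof.
by move=> a A B; rewrite /tensor_hom_fun linearP /= mulmxDl -scalemxAl.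
Qed.
HB.instance Definition _ V W V' W' f g :=
  GRing.isLinear.Build K (tensor V W) (tensor V' W') _ _
    (@tensor_hom_is_linear V W V' W' f g).

Definition tensor_hom (V W V' W' : vectType K)
    (f : 'Hom(V, V')) (g : 'Hom(W, W')) : 'Hom(tensor V W, tensor V' W') :=
  linfun (tensor_hom_fun f g).

Lemma tensor_homE (V W V' W' : vectType K)
    (f : 'Hom(V, V')) (g : 'Hom(W, W')) v w :
  tensor_hom f g (tens v w) = tens (f v) (g w).
Proof.
rewrite lfunE /= /tensor_hom_fun /tens.
rewrite (@rVof_app _ _ _ (e V) (e V')) ?vbasisP //.
rewrite (@rVof_app _ _ _ (e W) (e W')) ?vbasisP //.
by rewrite trmx_mul !mulmxA.
Qed.

Lemma tensor_hom_ext (V W : vectType K) (T : vectType K)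
    (f g : 'Hom(tensor V W, T)) :
  (forall v w, f (tens v w) = g (tens v w)) -> f = g.
Proof.
move=> fg; apply/lfunP=> A; rewrite [A]tensE !linear_sum.
apply: eq_bigr => i _; rewrite !linear_sum; apply: eq_bigr => j _.
by rewrite !linearZ /= fg.
Qed.

Section TensorModule.
Variables (M : monoidType) (V W : module K M).

Definition tensor_act s : 'End(tensor V W) := tensor_hom (mact V s) (mact W s).

Fact tensor_act1 : tensor_act 1%g = \1%VF.
Proof.
by apply: tensor_hom_ext => v w; rewrite tensor_homE !mact1 id_lfunE.
Qed.

Fact tensor_actM s t :
  tensor_act (s * t)%g = (tensor_act s \o tensor_act t)%VF.
Proof.
by apply: tensor_hom_ext => v w; rewrite comp_lfunE !tensor_homE !mactM.
Qed.

Definition tensor_module : module K M := Module tensor_act1 tensor_actM.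

End TensorModule.

End Tensor.

(** * Cell modules *)

Section CellModule.
Variables (K : fieldType) (n r : nat).

(* L_r is the L-class of the identity on {0, ..., r-1}, where r <= n; larger
   values of r are not meaningful. *)
Definition lcell : finType :=
  {s : ISn n | pdom s == [set x : 'I_n | (x < r)%N]}.

Definition cell_space : vectType K := {ffun lcell -> K^o}.

Definition cell_vec (p : lcell) : cell_space := [ffun q => (q == p)%:R].

(* [insub] tests whether the product s * p lies in L_r again. *)
Definition cell_mul (s : ISn n) (p : lcell) : cell_space :=
  if insub (s * val p)%g is Some q then cell_vec q else 0.

Definition cell_act_fun (s : ISn n) (f : cell_space) : cell_space :=
  \sum_(p : lcell) f p *: cell_mul s p.

Fact cell_act_is_linear s : linear (cell_act_fun s).
Proof.
move=> a f g; rewrite /cell_act_fun scaler_sumr -big_split.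
by apply: eq_bigr => p _; rewrite /= !ffunE scalerDl scalerA.
Qed.
HB.instance Definition _ s :=
  GRing.isLinear.Build K cell_space cell_space _ _ (cell_act_is_linear s).

Definition cell_act s : 'End(cell_space) := linfun (cell_act_fun s).

Lemma cell_actE s p : cell_act s (cell_vec p) = cell_mul s p.
Proof.
rewrite lfunE /= /cell_act_fun (bigD1 p) //= big1 => [|q qp].
  by rewrite ffunE eqxx scale1r addr0.
by rewrite ffunE (negPf qp) scale0r.
Qed.

Lemma cell_space_ext (T : vectType K) (f g : 'Hom(cell_space, T)) :
  (forall p, f (cell_vec p) = g (cell_vec p)) -> f = g.
Proof.
move=> fg; apply/lfunP=> x.
have -> : x = \sum_p x p *: cell_vec p.
  apply/ffunP=> q; rewrite sum_ffunE (bigD1 q) //= big1 => [|p pq].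
    by rewrite !ffunE eqxx addr0 [_ *: _]mulr1.
  by rewrite !ffunE eq_sym (negPf pq) scaler0.
by rewrite !linear_sum; apply: eq_bigr => p _; rewrite !linearZ /= fg.
Qed.

Fact cell_act1 : cell_act 1%g = \1%VF.
Proof.
apply: cell_space_ext => p; rewrite cell_actE id_lfunE /cell_mul mul1g.
by rewrite valK.
Qed.

Fact cell_actM s t : cell_act (s * t)%g = (cell_act s \o cell_act t)%VF.
Proof.
apply: cell_space_ext => p; rewrite comp_lfunE !cell_actE /cell_mul.
case: (insubP _ (t * val p)%g) => [q tpL qE|tpL].
  by rewrite cell_actE /cell_mul qE mulgA.
rewrite linear0 insubF //; apply: contraNF tpL => /eqP stpE.
have pdomM (u v : ISn n) : pdom (u * v)%g \subset pdom v.
  by apply/subsetP=> x; rewrite !inE ffunE; case: (v x).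
rewrite eqEsubset; apply/andP; split.
  by apply: subset_trans (pdomM _ _) _; rewrite (eqP (valP p)).
by apply: subset_trans (pdomM s _); rewrite mulgA stpE.
Qed.

Definition cell_module : module K (ISn n) := Module cell_act1 cell_actM.

End CellModule.

Definition cell_filtration (K : fieldType) (n : nat) (V : module K (ISn n))
    (F : filtration V) : Prop :=
  forall i, (i < flength F)%N ->
    exists2 r, (r <= n)%N &
      isomorphic (subquotient (F i.+1) (F i)) (cell_module K n r).

(* Main.v *)
Require Import Defs.
From HB Require Import structures.
From mathcomp Require Import all_boot all_order all_algebra.
From mathcomp Require Import ring.
From mathcomp Require Import boolp.

(** The tensor product has the basis of pairs [x = (p, q)] of injections with
    domains of sizes [k] and [l]. An element [s] of the semigroup sends the
    pair to [(s p, s q)] if [s] is defined on the support of the pair, that is,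
    on the union of the images of [p] and [q], and to zero otherwise.

    Existence of a cell filtration. The relation of being reachable by the
    semigroup is an equivalence relation on pairs, as partial injections have
    inverses. If the support of [x] has [r] elements, transport [x] to the first
    [r] points; multiplying the result by the elements of the [r]-th cell
    parametrizes the orbit of [x] ([card_orbit], [orbit_hom_img]), and this
    parametrization extends to a module map from the [r]-th cell module
    ([pair_hom_equivariant]). The images of these maps span, and the dimensions
    of their sources do not exceed in total the dimension of the tensor product,
    so adding the images one by one produces a filtration with these cell
    modules as subquotients ([filtration_of_sum]).

    Multiplicities. Let [e_r] be the idempotent that is the identity on the
    first [r] points. The rank of an idempotent is additive along filtrations
    ([act_rank_filtration]). On the [m]-th cell module, [e_r] keeps the
    injections with image among the first [r] points and kills the others, so
    its rank is the falling factorial [r ^_ m] ([act_rank_cell]); on the tensor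
    product its rank is [r ^_ k * r ^_ l] for the same reason
    ([act_rank_tensor]). Hence the multiplicities [mu m] in any cell filtration
    satisfy
      [r ^_ k * r ^_ l = \sum_(m <= r) mu m * r ^_ m]   for all [r <= n],
    a triangular system with non-zero diagonal entries [r ^_ r], which has a
    single solution ([ffact_coefs_unique]). Vandermonde's identity provides one
    ([ffact_mul_expand]): the number of ways to glue a [k]-set and an [l]-set
    into an [m]-set. *)

Set Implicit Arguments.
Unset Strict Implicit.
Unset Printing Implicit Defensive.

Import GRing.Theory passmx.
Local Open Scope ring_scope.

(** * Projections onto coordinate subspaces *)

Section Basis.
Variables (K : fieldType) (V : vectType K) (X : finType) (b : X -> V).
Hypothesis b_span : (\sum_x <[b x]> = fullv)%VS.
Hypothesis b_card : (#|X| <= \dim {:V})%N.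

Lemma dim_sum_lines (P : pred X) : (\dim (\sum_(x | P x) <[b x]>)%VS <= #|P|)%N.
Proof.
apply: (leq_trans (dimv_leq_sum _ _ _)).
rewrite -sum1_card; apply: leq_sum => x _.
by rewrite dim_vline; case: (_ == _).
Qed.

(** The lines in [P] and those outside [P] together span the space, and neither
    family can exceed its cardinal: as the cardinals add up to the dimension,
    both bounds are attained. *)
Lemma dim_basis_lines (P : pred X) : \dim (\sum_(x | P x) <[b x]>)%VS = #|P|.
Proof.
apply/eqP; rewrite eqn_leq dim_sum_lines /=.
rewrite -(leq_add2r #|predC P|) cardC.
apply: leq_trans b_card _; rewrite -b_span (bigID P) /=.
apply: (leq_trans (dimv_add_leqif _ _)).
by rewrite leq_add2l (dim_sum_lines (predC P)).
Qed.

Lemma dim_limg_projection (P : pred X) (e : 'End(V)) :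
  (forall x, e (b x) = if P x then b x else 0) -> \dim (limg e) = #|P|.
Proof.
move=> eb; rewrite -dim_basis_lines -b_span limg_sum [in RHS]big_mkcond.
congr (\dim _); apply: eq_bigr => x _ /=.
by rewrite limg_line eb; case: (P x).
Qed.
End Basis.

(** * The rank of an idempotent on a module *)

Section Modules.
Variables (K : fieldType) (M : monoidType).
Implicit Types V W : module K M.

Definition equivariant V W (f : 'Hom(V, W)) : Prop :=
  forall s v, f (mact V s v) = mact W s (f v).

Lemma isomorphic_inv V W (f : 'Hom(W, V)) :
  bijective f -> equivariant f -> isomorphic V W.
Proof.
move=> [g fK gK] fE.
have finj : lker f == 0%VS by apply/lker0P/can_inj/fK.
have fIK : cancel (f^-1)%VF f.
  by move=> v; rewrite -[v in LHS]gK lker0_lfunK // gK.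
exists (f^-1)%VF; split; first by exists f; last exact: lker0_lfunK.
move=> s v; apply: (can_inj fK).
by rewrite fE !fIK.
Qed.

Definition act_rank V s : nat := \dim (limg (mact V s)).

Lemma act_rank_iso V W s : isomorphic V W -> act_rank V s = act_rank W s.
Proof.
move=> [f [[g fK gK] fE]].
have finj : lker f == 0%VS by apply/lker0P/can_inj/fK.
have fsurj : limg f = fullv.
  apply/eqP; rewrite eqEsubv subvf; apply/subvP => w _.
  by rewrite -[w]gK memv_img ?memvf.
rewrite /act_rank -(@limg_dim_eq _ _ _ f (limg (mact V s))); last first.
  by rewrite (eqP finj) capv0.
rewrite -limg_comp -[in RHS]fsurj -limg_comp; congr (\dim (lfun_img _ _)).
by apply/lfunP => v; rewrite !comp_lfunE fE.
Qed.

Section Quot.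
Variables (V : module K M) (s : M).
Hypothesis ss : (s * s)%g = s.

(** Rank-nullity for the projection [h] restricted to the image of [s]. Since
    [s] is idempotent, a vector of that image lying in [U] is its own image
    under [s], so the kernel of the restriction is [s U]. *)
Lemma act_rank_quot (U : submodule V) :
  (act_rank (quot_module U) s + \dim (mact V s @: U) = act_rank V s)%N.
Proof.
pose h : 'Hom(V, quotv U) := linfun (proj_quotv U).
have hE v : h v = proj_quotv U v by rewrite lfunE.
have h_ker v : (v \in lker h) = (v \in U).
  by rewrite memv_ker hE -(linear0 (proj_quotv U)) proj_quotv_eq subr0.
have h_full : limg h = fullv.
  apply/eqP; rewrite eqEsubv subvf; apply/subvP => w _.
  by rewrite -[w]proj_reprK -hE memv_img ?memvf.
have -> : act_rank (quot_module U) s = \dim (h @: limg (mact V s)).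
  rewrite /act_rank -[in LHS]h_full -!limg_comp; congr (\dim (lfun_img _ _)).
  by apply/lfunP => v; rewrite !comp_lfunE /= !hE quot_actE.
rewrite /act_rank addnC -(limg_ker_dim h (limg (mact V s))).
congr (\dim _ + _)%N.
apply/eqP; rewrite eqEsubv; apply/andP; split.
  rewrite subv_cap limgS ?subvf //; apply/subvP => w /memv_imgP [v vU ->].
  by rewrite h_ker submoduleP.
apply/subvP => w /memv_capP [/memv_imgP [v _ ->]]; rewrite h_ker => svU.
by rewrite -{1}ss mactM memv_img.
Qed.
End Quot.

Lemma act_rank_subquotient V s (E F : submodule V) :
  (s * s)%g = s -> (F <= E)%VS ->
  (act_rank (subquotient E F) s + \dim (mact V s @: F)
    = \dim (mact V s @: E))%N.
Proof.
move=> ss FE.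
pose i : 'Hom(subvs_of E, V) := linfun (vsval : subvs_of E -> V).
have iE u : i u = vsval u by rewrite lfunE.
have iinj : lker i == 0%VS.
  by apply/lker0P => u v; rewrite !iE; apply: val_inj.
have iimg : limg i = E.
  apply/eqP; rewrite eqEsubv; apply/andP; split.
    by apply/subvP => _ /memv_imgP [u _ ->]; rewrite iE subvsP.
  by apply/subvP => v vE; rewrite -(vsprojK vE) -iE memv_img ?memvf.
have di (S : {vspace subvs_of E}) :
    \dim (mact (sub_module E) s @: S) = \dim (mact V s @: (i @: S)).
  rewrite -(@limg_dim_eq _ _ _ i); last by rewrite (eqP iinj) capv0.
  rewrite -!limg_comp; congr (\dim (lfun_img _ _)).
  by apply/lfunP => v; rewrite !comp_lfunE /= !iE sub_actE.
have := @act_rank_quot (sub_module E) s ss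
  (Submodule (@trace_spaceP _ _ _ E F)).
rewrite /= /act_rank !di iimg => <-; congr (_ + \dim (_ @: _))%N.
by rewrite lpreimK // iimg.
Qed.

(** The ranks of the subquotients telescope. *)
Lemma act_rank_filtration V s (F : filtration V) : (s * s)%g = s ->
  act_rank V s =
    (\sum_(i < flength F) act_rank (subquotient (F i.+1) (F i)) s)%N.
Proof.
case: F => t F F0 FS Ft ss /=.
suff H i : (i <= t)%N -> \dim (mact V s @: F i) =
    (\sum_(j < i) act_rank (subquotient (F j.+1) (F j)) s)%N.
  by rewrite -H // Ft.
elim: i => [|i IH] it; first by rewrite F0 limg0 dimv0 big_ord0.
by rewrite big_ord_recr -IH ?(ltnW it) //= addnC act_rank_subquotient ?FS.
Qed.

End Modules.

(** * Filtrations of sums of images of module maps *)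

Section FiltrationOfSum.
Variables (K : fieldType) (M : monoidType) (V : module K M).
Variables (T : Type) (W : T -> module K M) (f : forall t, 'Hom(W t, V)).
Hypothesis fE : forall t, equivariant (f t).

Fact sum_imagesP (ts : seq T) s v :
  v \in (\sum_(t <- ts) limg (f t))%VS ->
  mact V s v \in (\sum_(t <- ts) limg (f t))%VS.
Proof.
move=> vU; apply: subvP (memv_img (mact V s) vU).
rewrite limg_sum; elim/big_ind2: _ => // [U U' V' V'' sU sV|t _].
  exact: addvS.
apply/subvP => _ /memv_imgP [_ /memv_imgP [w _ ->] ->].
by rewrite -fE memv_img ?memvf.
Qed.

Definition sum_images ts : submodule V := Submodule (@sum_imagesP ts).

Lemma dim_sum_images ts :
  (\dim (sum_images ts) <= \sum_(t <- ts) \dim {: W t})%N.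
Proof.
apply: (leq_trans (dimv_leq_sum _ _ _)); apply: leq_sum => t _.
by rewrite -[X in (_ <= X)%N](limg_ker_dim (f t)) leq_addl.
Qed.

(** The hypothesis on dimensions forces the new map [f t] to be injective with
    image independent of the previous term; composed with the projection it is
    then an isomorphism onto the subquotient. *)
Lemma subquotient_sum_images ts t :
  \dim (sum_images (rcons ts t)) = (\dim (sum_images ts) + \dim {: W t})%N ->
  isomorphic (subquotient (sum_images (rcons ts t)) (sum_images ts)) (W t).
Proof.
set E := sum_images _; set F := sum_images _ => dimE.
have EF : subspace_of E = (F + limg (f t))%VS.
  by rewrite /E /F /= big_rcons.
have /andP [/eqP fdim /eqP cap0] :
    (\dim (limg (f t)) == \dim {: W t}) && (F :&: limg (f t) == 0)%VS.
  have le1 : (\dim (limg (f t)) <= \dim {: W t})%N.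
    by rewrite -[X in (_ <= X)%N](limg_ker_dim (f t)) leq_addl.
  have := dimv_sum_cap F (limg (f t)); rewrite -EF dimE -addnA => /eqP.
  rewrite eqn_add2l => /eqP sumE; move: le1; rewrite -sumE -dimv_eq0.
  rewrite -[X in (_ <= X)%N]addn0 leq_add2l leqn0 => /eqP ->.
  by rewrite addn0 !eqxx.
have finj w : f t w = 0 -> w = 0.
  move=> fw; apply/eqP; rewrite -memv0.
  have /eqP <- : lker (f t) == 0%VS.
    rewrite -dimv_eq0 -(eqn_add2r (\dim {: W t})) -[X in (_ + X == _)%N]fdim.
    by have := limg_ker_dim (f t) fullv; rewrite capfv => ->.
  by rewrite memv_ker fw.
have fInE w : f t w \in E.
  by rewrite EF (subvP (addvSr _ _)) ?memv_img ?memvf.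
set tr := trace_space E F.
pose g : 'Hom(W t, quotv tr) :=
  (linfun (proj_quotv tr) \o linfun (vsproj E) \o f t)%VF.
have gE w : g w = proj_quotv tr (vsproj E (f t w)).
  by rewrite !comp_lfunE !lfunE.
have projE w : vsval (vsproj E (f t w)) = f t w by rewrite vsprojK.
apply: (@isomorphic_inv _ _ _ _ (g : 'Hom(_, subquotient E F))); last first.
  move=> s w; rewrite !gE [RHS]quot_actE; congr (proj_quotv _ _).
  apply: val_inj; rewrite [RHS]sub_actE projE -[RHS](fE s w); exact: projE.
have ginj : injective g.
  apply: (@raddf_inj _ _ g) => w gw; have /eqP : g w = 0 by [].
  rewrite gE -(linear0 (proj_quotv tr)) proj_quotv_eq subr0.
  rewrite trace_spaceE projE => fwF.
  apply: finj.
  by apply/eqP; rewrite -memv0 -cap0 memv_cap fwF memv_img ?memvf.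
have gsurj q : exists w, g w = q.
  rewrite -[q]proj_reprK; set u := repr q.
  have : vsval u \in (F + limg (f t))%VS by rewrite -EF subvsP.
  move=> /memv_addP [a aF [_ /memv_imgP [w _ ->] ua]].
  exists w; rewrite gE; apply/eqP; rewrite eq_sym proj_quotv_eq trace_spaceE.
  by rewrite /= projE ua addrK.
have [h hK] := choice gsurj.
by exists h => // w; apply: ginj; rewrite hK.
Qed.

(** Counting dimensions makes the sum of the images direct: every partial sum
    has dimension at most the sum of the dimensions of its sources, and equality
    for the whole sum forces equality at each stage. *)
Lemma filtration_of_sum (ts : seq T) :
  (\sum_(t <- ts) limg (f t) = fullv)%VS ->
  (\sum_(t <- ts) \dim {: W t} <= \dim {: V})%N ->
  exists F : filtration V, forall i, (i < flength F)%N ->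
    exists t, isomorphic (subquotient (F i.+1) (F i)) (W t).
Proof.
move=> full dims.
have dimE i : \dim (sum_images (take i ts)) =
    (\sum_(t <- take i ts) \dim {: W t})%N.
  apply/eqP; rewrite eqn_leq dim_sum_images /=.
  rewrite -(leq_add2r (\sum_(t <- drop i ts) \dim {: W t})).
  rewrite -big_cat cat_take_drop.
  apply: leq_trans dims _; rewrite -full -{1}(cat_take_drop i ts) big_cat /=.
  apply: (leq_trans (dimv_add_leqif _ _)).
  by rewrite leq_add2l (dim_sum_images (drop i ts)).
have takeS t0 i : (i < size ts)%N ->
    take i.+1 ts = rcons (take i ts) (nth t0 ts i) by exact: take_nth.
have F0 : sum_images (take 0 ts) = 0%VS :> {vspace V}.
  by rewrite /= take0 big_nil.
have Ft : sum_images (take (size ts) ts) = fullv :> {vspace V}.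
  by rewrite take_size.
have FS i : (i < size ts)%N ->
    (sum_images (take i ts) <= sum_images (take i.+1 ts))%VS.
  case: ts {full dims dimE F0 Ft} takeS => // t0 ts takeS it.
  by rewrite (takeS t0) //= big_rcons addvSl.
exists (@Filtration _ _ _ _ (fun i => sum_images (take i ts)) F0 FS Ft).
move=> i /= it.
have [t0 _] : {t : T | true} by case: (ts) it => // t _ _; exists t.
exists (nth t0 ts i); have := dimE i.+1; rewrite (takeS t0) // => dimE1.
apply: subquotient_sum_images; rewrite dimE1 dimE.
by rewrite big_rcons.
Qed.

End FiltrationOfSum.

(** * Products of falling factorials *)

Section FallingFactorials.
Local Open Scope nat_scope.

(** The number of partial bijections of size [k + l - m] between a [k]-set and
    an [l]-set: the ways of gluing the two sets into a set of size [m]. The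
    test excludes the [m] for which the truncated subtraction is meaningless;
    for [m] below [k] or [l] a binomial coefficient vanishes. *)
Definition overlaps (k l m : nat) : nat :=
  if m <= k + l then 'C(k, k + l - m) * 'C(l, k + l - m) * (k + l - m)`! else 0.

Lemma ffactD (x k j : nat) : x ^_ (k + j) = x ^_ k * (x - k) ^_ j.
Proof.
rewrite !ffact_prod big_split_ord; congr (_ * _).
by apply: eq_bigr => i _; rewrite subnDA.
Qed.

(** A pair of injections of a [k]-set and an [l]-set into an [r]-set is a gluing
    of the two sets together with an injection of the result. Algebraically,
    Vandermonde's convolution of [(k + (r - k)) choose l], multiplied by
    [r ^_ k * l`!], becomes this sum once indexed by the overlap
    [j = k + l - m]; if [r < k], both sides vanish. *)
Lemma ffact_mul_expand (k l r : nat) :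
  r ^_ k * r ^_ l = \sum_(m < r.+1) overlaps k l m * r ^_ m.
Proof.
pose N := (k + l + r).+1.
have -> : \sum_(m < r.+1) overlaps k l m * r ^_ m =
          \sum_(0 <= m < (k + l).+1) overlaps k l m * r ^_ m.
  transitivity (\sum_(0 <= m < N) overlaps k l m * r ^_ m).
    rewrite (@big_cat_nat _ _ _ r.+1) ?ltnS ?leq_addl //=.
    rewrite [X in _ + X]big_nat_cond.
    rewrite [X in _ + X]big1 ?addn0 ?big_mkord // => m /andP [/andP [rm _] _].
    by rewrite ffact_small ?muln0.
  rewrite (@big_cat_nat _ _ _ (k + l).+1) ?ltnS ?leq_addr //=.
  rewrite [X in _ + X]big_nat_cond.
  rewrite [X in _ + X]big1 ?addn0 // => m /andP [/andP [rm _] _].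
  by rewrite /overlaps leqNgt rm.
(* From the size [m] of the union to the overlap [j = k + l - m]. *)
rewrite big_nat_rev /= add0n.
have -> : \sum_(0 <= j < (k + l).+1)
      overlaps k l ((k + l).+1 - j.+1) * r ^_ ((k + l).+1 - j.+1) =
    \sum_(0 <= j < l.+1) 'C(k, j) * 'C(l, j) * j`! * r ^_ (k + l - j).
  rewrite (@big_cat_nat _ _ _ l.+1) ?ltnS ?leq_addl //=.
  rewrite [X in _ + X]big_nat_cond.
  rewrite [X in _ + X]big1 ?addn0 => [|j /andP [/andP [lj jkl] _]].
    apply: eq_big_nat => j /andP [_ jl].
    rewrite subSS /overlaps leq_subr subKn //.
    by rewrite (leq_trans _ (leq_addl k l)).
  rewrite subSS /overlaps leq_subr subKn //.
  by rewrite ['C(l, j)]bin_small // muln0.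
case: (leqP k r) => [kr|rk]; last first.
  rewrite ffact_small // mul0n big_nat_cond big1 // => j.
  move=> /andP [/andP [_ jl] _].
  rewrite [r ^_ _]ffact_small ?muln0 // (leq_trans rk) //.
  by rewrite -addnBA // leq_addr.
rewrite -(bin_ffact r l) -{2}(subnKC kr) -binomial.Vandermonde big_mkord.
rewrite big_distrl big_distrr /=.
apply: eq_bigr => -[j /= jl] _.
rewrite -addnBA // ffactD -(bin_ffact (r - k)) -{1}(bin_fact (jl : j <= l)).
ring.
Qed.

(** The system is triangular: [r ^_ s] vanishes for [s > r], and [r ^_ r] does
    not. *)
Lemma ffact_coefs_unique (mu nu : nat -> nat) (n : nat) :
  (forall r, r <= n ->
     \sum_(s < r.+1) mu s * r ^_ s = \sum_(s < r.+1) nu s * r ^_ s) ->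
  forall m, m <= n -> mu m = nu m.
Proof.
move=> H; elim/ltn_ind => m IH mn; have := H m mn.
rewrite !big_ord_recr /= (eq_bigr (fun s : 'I_m => nu s * m ^_ s)) => [|s _].
  move/eqP; rewrite eqn_add2l eqn_pmul2r ?ffact_gt0 // => /eqP //.
by rewrite IH // ltnW // (leq_trans (ltn_ord s)).
Qed.

Lemma overlapsE (k l m : nat) : maxn k l <= m <= k + l ->
  let b := k + l - m in let a := k - b in let c := l - b in
  ((overlaps k l m)%:R : rat)%R =
     (((a + b)`! * (b + c)`!)%:R / (a`! * b`! * c`!)%:R)%R.
Proof.
rewrite geq_max => /andP [/andP [km lm] mkl] b a c.
have bk : b <= k by rewrite leq_subLR addnC leq_add2r.
have bl : b <= l by rewrite leq_subLR leq_add2r.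
have nz : ((a`! * b`! * c`!)%:R : rat)%R != 0%R.
  by rewrite Num.Theory.pnatr_eq0 -lt0n !muln_gt0 !fact_gt0.
apply: (mulIf nz); rewrite divfK // -natrM; congr (_%:R)%R.
rewrite /overlaps mkl -/b subnK // subnKC // -(bin_fact bk) -(bin_fact bl).
rewrite -/a -/c.
ring.
Qed.

End FallingFactorials.

(** * Inverses and idempotents in the symmetric inverse semigroup *)

Section PartialInjections.
Variable n : nat.
Implicit Types s t p q : ISn n.

Definition initial r : {set 'I_n} := [set x : 'I_n | (x < r)%N].

Lemma ISn_mulE s t x : (s * t)%g x = obind s (t x).
Proof. by rewrite ffunE. Qed.

Lemma ISn_inj s x y u : s x = Some u -> s y = Some u -> x = y.
Proof. by move=> sx sy; apply: (@pfun_inj _ s); rewrite ?sx ?sy. Qed.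

Lemma mem_pdom s x u : s x = Some u -> x \in pdom s.
Proof. by rewrite inE => ->. Qed.

Lemma pdomP s x : reflect (exists u, s x = Some u) (x \in pdom s).
Proof.
rewrite inE; case: (s x) => [u|]; constructor; first by exists u.
by case.
Qed.

Lemma pdom_mul s t : pdom (s * t)%g \subset pdom t.
Proof. by apply/subsetP=> x; rewrite !inE ISn_mulE; case: (t x). Qed.

Fact inv_subproof s : partial_inj [ffun y => [pick x | s x == Some y]].
Proof.
apply/partial_injP => y z; rewrite !ffunE.
case: pickP => // x /eqP sx _; case: pickP => // x' /eqP sx' [xx'].
by move: sx; rewrite xx' sx' => -[].
Qed.
Definition ISn_inv s : ISn n := PartialInj (inv_subproof s).

Lemma ISn_invE s x y : (ISn_inv s y = Some x) <-> (s x = Some y).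
Proof.
rewrite ffunE; case: pickP => [z /eqP sz|sy]; split=> //.
- by case=> <-.
- by move=> sx; rewrite (ISn_inj sx sz).
- by move=> sx; have := sy x; rewrite sx eqxx.
Qed.

Lemma ISn_mulVK s t : pdom (s * t)%g = pdom t -> (ISn_inv s * (s * t))%g = t.
Proof.
move=> /setP dom; apply: ISn_ext => x; rewrite ISn_mulE.
have := dom x; rewrite !inE !ISn_mulE; case: (t x) => //= u.
by case su: (s u) => [v|] //= _; apply/ISn_invE.
Qed.

Lemma ISn_invK s : ISn_inv (ISn_inv s) = s.
Proof.
apply: ISn_ext => x; case sx: (s x) => [y|].
  by apply/ISn_invE/ISn_invE.
case E: (ISn_inv _ _) => [y|] //.
by move/ISn_invE/ISn_invE: E; rewrite sx.
Qed.

Fact idem_subproof r :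
  partial_inj [ffun x : 'I_n => if (x < r)%N then Some x else None].
Proof.
apply/partial_injP => x y; rewrite !ffunE.
by case: ifP => // _ _; case: ifP => // _ [].
Qed.
Definition idem r : ISn n := PartialInj (idem_subproof r).

Lemma idemM r : (idem r * idem r)%g = idem r.
Proof.
apply: ISn_ext => x; rewrite ISn_mulE !ffunE.
by case: ifP => //= xr; rewrite ffunE xr.
Qed.

Lemma idem_fix r s : pdom (idem r * s)%g = pdom s -> (idem r * s)%g = s.
Proof.
move=> /setP dom; apply: ISn_ext => x; have := dom x.
by rewrite !inE ISn_mulE; case: (s x) => //= u; rewrite ffunE; case: ifP.
Qed.

Lemma idem_fixP r s :
  reflect (forall x y, s x = Some y -> (y < r)%N) ((idem r * s)%g == s).
Proof.
apply: (iffP eqP) => [sE x y sx|sr].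
  by move: (sx); rewrite -{1}sE ISn_mulE sx /= ffunE; case: ifP.
apply: ISn_ext => x; rewrite ISn_mulE; case sx: (s x) => [y|] //=.
by rewrite ffunE (sr _ _ sx).
Qed.

Fact enum_inj_subproof (U : {set 'I_n}) :
  partial_inj
    [ffun x : 'I_n =>
       omap (@enum_val _ (mem U)) (insub (val x) : option 'I_#|U|)].
Proof.
apply/partial_injP => x y; rewrite !ffunE.
case: insubP => //= i _ ix _; case: insubP => //= j _ jy [] /enum_val_inj ij.
by apply: val_inj; rewrite /= -ix -jy ij.
Qed.
Definition enum_inj U : ISn n := PartialInj (enum_inj_subproof U).

Lemma pdom_enum_inj U : pdom (enum_inj U) = initial #|U|.
Proof.
by apply/setP => x; rewrite !inE ffunE; case: insubP => [i -> //|/negPf ->].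
Qed.

Lemma enum_inj_in U x u : enum_inj U x = Some u -> u \in U.
Proof. by rewrite ffunE; case: insubP => //= i _ _ [<-]; apply: enum_valP. Qed.

Lemma enum_inj_onto (U : {set 'I_n}) u :
  u \in U -> exists x, enum_inj U x = Some u.
Proof.
move=> uU; have Un : (#|U| <= n)%N.
  by rewrite -[n in (_ <= n)%N]card_ord max_card.
exists (widen_ord Un (enum_rank_in uU u)); rewrite ffunE /= valK /=.
by rewrite enum_rankK_in.
Qed.

Lemma pdom_inv_enum_inj U : pdom (ISn_inv (enum_inj U)) = U.
Proof.
apply/setP => u; apply/pdomP/idP => [[x /ISn_invE/enum_inj_in//]|].
by move=> /enum_inj_onto [x xu]; exists x; apply/ISn_invE.
Qed.

Lemma pdom_mul_inv_enum_inj (U : {set 'I_n}) s :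
  (forall x u, s x = Some u -> u \in U) ->
  pdom (ISn_inv (enum_inj U) * s)%g = pdom s.
Proof.
move=> sU; apply/eqP; rewrite eqEsubset pdom_mul.
apply/subsetP => x /pdomP [u xu].
have : u \in pdom (ISn_inv (enum_inj U)).
  by rewrite pdom_inv_enum_inj (sU x).
by move=> /pdomP [v uv]; apply/pdomP; exists v; rewrite ISn_mulE xu.
Qed.

Lemma enum_inj_mulVK (U : {set 'I_n}) s :
  (forall x u, s x = Some u -> u \in U) ->
  (enum_inj U * (ISn_inv (enum_inj U) * s))%g = s.
Proof.
move=> sU; rewrite -{1}[enum_inj U]ISn_invK ISn_mulVK //.
exact: pdom_mul_inv_enum_inj.
Qed.

(** Elements of the cell with values among the first [r] points are injections
    of an [s]-set into an [r]-set. *)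
Lemma card_lcell_into (r s : nat) : (r <= n)%N -> (s <= n)%N ->
  #|[pred q : lcell n s | (idem r * val q)%g == val q]| = r ^_ s.
Proof.
move=> rn sn; pose w := widen_ord sn.
pose F (q : lcell n s) : {ffun 'I_s -> 'I_n} :=
  [ffun j => odflt (w j) (val q (w j))].
(* The default [w j] is never used, as [w j] lies in the domain of [q]. *)
have FE (q : lcell n s) j : val q (w j) = Some (F q j).
  rewrite ffunE; have : w j \in pdom (val q) by rewrite (eqP (valP q)) inE /=.
  by case/pdomP => u ->.
have Finj : injective F.
  move=> q q' qq'; apply/val_inj/ISn_ext => x.
  have /setP /(_ x) := eqP (valP q); have /setP /(_ x) := eqP (valP q').
  rewrite !inE; case: (ltnP x s) => [xs _ _|_].
    have -> : x = w (Ordinal xs) by apply: val_inj.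
    by rewrite !FE qq'.
  by move=> /negbFE/eqP -> /negbFE/eqP ->.
rewrite -(card_imset _ Finj) -[s in RHS]card_ord.
have cr : r = #|[pred y : 'I_n | (y < r)%N]|.
  rewrite -[LHS]card_ord -(card_codom (f := widen_ord rn)).
    apply: eq_card => y; rewrite !inE.
    apply/codomP/idP => [[j ->]|yr] /=; first exact: ltn_ord.
    by exists (Ordinal yr); apply: val_inj.
  by move=> i j /(congr1 val) /= ij; apply: val_inj.
rewrite [in RHS]cr -card_inj_ffuns_on; apply: eq_card => f.
rewrite !inE; apply/imsetP/andP => [[q]|[/ffun_onP fr /injectiveP finj]].
  rewrite inE => /idem_fixP qr ->; split.
    by apply/ffun_onP => j; rewrite inE; apply: qr _ _ (FE q j).
  apply/injectiveP => i j Fij; apply: val_inj.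
  suff /(congr1 val) : w i = w j by [].
  by apply: ISn_inj (FE q i) _; rewrite FE Fij.
have pinj : partial_inj
    [ffun x : 'I_n => omap f (insub (val x) : option 'I_s)].
  apply/partial_injP => x y; rewrite !ffunE.
  case: insubP => //= i _ ix _; case: insubP => //= j _ jy [] /finj ij.
  by apply: val_inj; rewrite /= -ix -jy ij.
have pL : pdom (PartialInj pinj) == [set x : 'I_n | (x < s)%N].
  apply/eqP/setP => x; rewrite !inE ffunE.
  by case: insubP => [i -> //|/negPf ->].
exists (Sub (PartialInj pinj) pL : lcell n s); last first.
  by apply/ffunP => j; rewrite ffunE SubK ffunE /= valK.
rewrite inE SubK; apply/idem_fixP => x y; rewrite ffunE.
by case: insubP => //= i _ _ [<-]; have := fr i; rewrite inE.
Qed.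

End PartialInjections.

(** * The bases of cell modules and of their tensor products *)

Section CellBasis.
Variables (K : fieldType) (n : nat).

Lemma cell_vec_expand r (v : cell_space K n r) : v = \sum_p v p *: cell_vec K p.
Proof.
apply/ffunP=> q; rewrite sum_ffunE (bigD1 q) //= big1 => [|p pq].
  by rewrite !ffunE eqxx addr0 [_ *: _]mulr1.
by rewrite !ffunE eq_sym (negPf pq) scaler0.
Qed.

Lemma dim_cell_space r : \dim {: cell_space K n r} = #|lcell n r|.
Proof. by rewrite dimvf /dim /= muln1. Qed.

Lemma cell_vec_span r :
  (\sum_p <[cell_vec K p]> = fullv :> {vspace cell_space K n r})%VS.
Proof.
apply/eqP; rewrite eqEsubv subvf; apply/subvP => v _.
rewrite [v]cell_vec_expand; apply: rpred_sum => p _; apply: rpredZ.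
by rewrite (subvP (sumv_sup p _ (subvv _))) ?memv_line.
Qed.

Lemma idem_cell_vec r s (q : lcell n s) :
  mact (cell_module K n s) (idem n r) (cell_vec K q) =
    if (idem n r * val q)%g == val q then cell_vec K q else 0.
Proof.
rewrite [LHS]cell_actE /cell_mul.
case: (altP eqP) => [-> | neq]; first by rewrite valK.
rewrite insubF //; apply/negP => /eqP dom.
by case/eqP: neq; apply: idem_fix; rewrite dom (eqP (valP q)).
Qed.

Lemma act_rank_cell r s : (r <= n)%N -> (s <= n)%N ->
  act_rank (cell_module K n s) (idem n r) = r ^_ s.
Proof.
move=> rn sn; rewrite -(card_lcell_into rn sn).
apply: (dim_limg_projection (b := @cell_vec K n s)); first exact: cell_vec_span.
  by rewrite dim_cell_space.
exact: idem_cell_vec.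
Qed.

(** The action of the semigroup on basis vectors, extended to all partial
    injections so that products need no proof of membership in the cell. *)
Definition ISn_vec m (u : ISn n) : cell_space K n m :=
  if insub u is Some t then cell_vec K t else 0.

Lemma ISn_vec_val m (t : lcell n m) : ISn_vec m (val t) = cell_vec K t.
Proof. by rewrite /ISn_vec valK. Qed.

Lemma ISn_vec0 m (u : ISn n) : pdom u != initial n m -> ISn_vec m u = 0.
Proof. by move=> u0; rewrite /ISn_vec insubN. Qed.

(** The inclusion cannot be dropped: if [u] were defined on more points than the
    cell allows, [s * u] could fall back into the cell. *)
Lemma mact_ISn_vec m (s u : ISn n) : pdom u \subset initial n m ->
  mact (cell_module K n m) s (ISn_vec m u) = ISn_vec m (s * u)%g.
Proof.
move=> um; case: (eqVneq (pdom u) (initial n m)) => [uE|uE].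
  have uL : pdom u == [set x : 'I_n | (x < m)%N] by apply/eqP.
  have -> : u = val (Sub u uL : lcell n m) by rewrite SubK.
  rewrite ISn_vec_val.
  exact: cell_actE.
rewrite ISn_vec0 // linear0 ISn_vec0 //; apply: contraNneq uE => suE.
by rewrite eqEsubset um -suE pdom_mul.
Qed.

Lemma tens0l (V W : vectType K) (w : W) : tens (0 : V) w = 0.
Proof. by rewrite /tens linear0 trmx0 mul0mx. Qed.

Lemma tens0r (V W : vectType K) (v : V) : tens v (0 : W) = 0.
Proof. by rewrite /tens linear0 mulmx0. Qed.

Lemma tens_sum (V W : vectType K) (I J : finType) (a : I -> K) (v : I -> V)
    (c : J -> K) (w : J -> W) :
  tens (\sum_i a i *: v i) (\sum_j c j *: w j) =
    \sum_i \sum_j (a i * c j) *: tens (v i) (w j).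
Proof.
elim: (index_enum I) => [|i r IH]; first by rewrite !big_nil tens0l.
rewrite !big_cons tensDl IH; congr (_ + _); rewrite {IH}.
elim: (index_enum J) => [|j t IH]; first by rewrite !big_nil tens0r scaler0.
by rewrite !big_cons tensDr scalerDr scalerA IH.
Qed.

Section TensorBasis.
Variables k l : nat.
Local Notation X := (lcell n k * lcell n l)%type.
Local Notation V := (tensor_module (cell_module K n k) (cell_module K n l)).

Definition pair_vec (x : X) : V := tens (cell_vec K x.1) (cell_vec K x.2).

Lemma dim_tensor_cells : \dim {: V} = #|{: X}|.
Proof. by rewrite dimvf /dim /= card_prod !dim_cell_space. Qed.

Lemma pair_vec_span : (\sum_x <[pair_vec x]> = fullv)%VS.
Proof.
apply/eqP; rewrite eqEsubv subvf; apply/subvP => A _; rewrite [A]tensE.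
apply: rpred_sum => i _; apply: rpred_sum => j _; apply: rpredZ.
set v := _`_i; set w := _`_j.
rewrite [v]cell_vec_expand [w]cell_vec_expand tens_sum.
apply: rpred_sum => p _; apply: rpred_sum => q _; apply: rpredZ.
by rewrite (subvP (sumv_sup (p, q) _ (subvv _))) ?memv_line.
Qed.

Lemma act_rank_tensor r : (r <= n)%N -> (k <= n)%N -> (l <= n)%N ->
  act_rank V (idem n r) = (r ^_ k * r ^_ l)%N.
Proof.
move=> rn kn ln.
rewrite -(card_lcell_into rn kn) -(card_lcell_into rn ln) -cardX.
apply: (dim_limg_projection pair_vec_span); first by rewrite dim_tensor_cells.
move=> [p q]; rewrite /pair_vec [LHS]tensor_homE !idem_cell_vec /= !inE /=.
by case: (_ == val p); case: (_ == val q); rewrite ?tens0l ?tens0r.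
Qed.

End TensorBasis.

End CellBasis.

(** * The module map attached to a pair of injections *)

Section PairHom.
Variables (K : fieldType) (n k l r : nat) (p q : ISn n).
Hypotheses (pk : pdom p = initial n k) (ql : pdom q = initial n l).
Hypothesis pq_onto :
  forall i : 'I_n, (i < r)%N <-> exists j, p j = Some i \/ q j = Some i.

(** Why the map below is equivariant: multiplication by [s] kills the pair if
    and only if it kills the elements of the [r]-th cell. *)
Lemma pdom_mul_initial (s : ISn n) :
  (initial n r \subset pdom s) =
  (pdom (s * p)%g == initial n k) && (pdom (s * q)%g == initial n l).
Proof.
rewrite -pk -ql; apply/subsetP/andP => [sr|[/eqP sp /eqP sq] i].
  have sub (u : ISn n) : (forall j i, u j = Some i -> (i < r)%N) ->
      pdom (s * u)%g == pdom u.
    move=> ur; rewrite eqEsubset pdom_mul; apply/subsetP => j /pdomP [i uj].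
    have /sr/pdomP[v si] : i \in initial n r by rewrite inE (ur j).
    by apply/pdomP; exists v; rewrite ISn_mulE uj /= si.
  by split; apply: sub => j i ji; apply/pq_onto; exists j; [left|right].
rewrite inE => /pq_onto [j].
have sub (u : ISn n) : pdom (s * u)%g = pdom u -> u j = Some i -> i \in pdom s.
  move=> /setP /(_ j) su uj; move: su; rewrite (mem_pdom uj).
  by case/pdomP => v; rewrite ISn_mulE uj => /mem_pdom.
by case; exact: sub.
Qed.

Lemma pair_inj (s t : ISn n) : pdom s = initial n r -> pdom t = initial n r ->
  (s * p)%g = (t * p)%g -> (s * q)%g = (t * q)%g -> s = t.
Proof.
move=> ds dt sp sq; apply: ISn_ext => i.
case: (boolP (i \in initial n r)) => [|ir]; last first.
  move: (ir); rewrite -{1}ds inE negbK => /eqP ->.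
  by move: ir; rewrite -dt inE negbK => /eqP ->.
rewrite inE => /pq_onto [j [] ji].
  by have := congr1 (fun u : ISn n => u j) sp; rewrite !ISn_mulE ji.
by have := congr1 (fun u : ISn n => u j) sq; rewrite !ISn_mulE ji.
Qed.

Local Notation V := (tensor_module (cell_module K n k) (cell_module K n l)).

(** The images of [p] and [q] jointly cover the first [r] points, so the
    semigroup acts on the pairs [(t p, t q)], for [t] in the [r]-th cell, exactly
    as it acts on the elements [t] themselves. *)
Definition pair_hom_fun (v : cell_space K n r) : V :=
  \sum_t v t *: tens (ISn_vec K k (val t * p)%g) (ISn_vec K l (val t * q)%g).

Fact pair_hom_is_linear : linear pair_hom_fun.
Proof.
move=> a v w; rewrite /pair_hom_fun scaler_sumr -big_split.
by apply: eq_bigr => t _; rewrite /= !ffunE scalerDl scalerA.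
Qed.
HB.instance Definition _ :=
  GRing.isLinear.Build K (cell_space K n r) V _ _ pair_hom_is_linear.

Definition pair_hom : 'Hom(cell_module K n r, V) := linfun pair_hom_fun.

Lemma pair_homE t : pair_hom (cell_vec K t) =
  tens (ISn_vec K k (val t * p)%g) (ISn_vec K l (val t * q)%g).
Proof.
rewrite lfunE /= /pair_hom_fun (bigD1 t) //= big1 => [|u ut].
  by rewrite ffunE eqxx scale1r addr0.
by rewrite ffunE (negPf ut) scale0r.
Qed.

Lemma pair_hom_equivariant : equivariant pair_hom.
Proof.
move=> s v; rewrite [v]cell_vec_expand !linear_sum; apply: eq_bigr => t _.
rewrite !linearZ /=; congr (_ *: _).
have tr : pdom (val t) = initial n r by exact: eqP (valP t).
have sub (u : ISn n) m : pdom u = initial n m ->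
    pdom (val t * u)%g \subset initial n m.
  by move=> <-; apply: pdom_mul.
rewrite pair_homE [RHS]tensor_homE !mact_ISn_vec ?sub // !mulgA.
rewrite [X in pair_hom X]cell_actE /cell_mul.
case: insubP => [u _ <-|stL]; first exact: pair_homE.
rewrite linear0.
have : ~~ (initial n r \subset pdom (s * val t)%g).
  apply: contraNN stL => sr; suff : pdom (s * val t)%g == initial n r by [].
  by rewrite eqEsubset sr andbT -tr pdom_mul.
rewrite pdom_mul_initial negb_and => /orP [] d0; rewrite (ISn_vec0 K d0).
  by rewrite tens0l.
by rewrite tens0r.
Qed.

End PairHom.

(** * Decomposition of the tensor product into orbits *)

Section Orbits.
Variables (K : fieldType) (n k l : nat).
Local Notation X := (lcell n k * lcell n l)%type.
Local Notation V := (tensor_module (cell_module K n k) (cell_module K n l)).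
Implicit Types x y z : X.

Definition moves x : pred X := fun y =>
  [exists s : ISn n,
     ((s * val x.1)%g == val y.1) && ((s * val x.2)%g == val y.2)].

Lemma movesP x y :
  reflect
    (exists2 s : ISn n, (s * val x.1)%g = val y.1 & (s * val x.2)%g = val y.2)
    (moves x y).
Proof.
apply: (iffP existsP) => [[s /andP [/eqP s1 /eqP s2]]|[s s1 s2]];
  exists s => //.
by rewrite s1 s2 !eqxx.
Qed.

Lemma moves_refl x : moves x x.
Proof. by apply/movesP; exists 1%g; rewrite mul1g. Qed.

Lemma moves_trans x y z : moves x y -> moves y z -> moves x z.
Proof.
move=> /movesP [s s1 s2] /movesP [t t1 t2]; apply/movesP.
by exists (t * s)%g; rewrite -mulgA ?s1 ?s2.
Qed.

Lemma moves_sym x y : moves x y -> moves y x.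
Proof.
move=> /movesP [s s1 s2]; apply/movesP.
exists (ISn_inv s).
  by rewrite -s1 ISn_mulVK // s1 (eqP (valP x.1)) (eqP (valP y.1)).
by rewrite -s2 ISn_mulVK // s2 (eqP (valP x.2)) (eqP (valP y.2)).
Qed.

Definition orbit_repr x : X := odflt x [pick y | moves x y].

Lemma moves_repr x : moves x (orbit_repr x).
Proof. by rewrite /orbit_repr; case: pickP => // _; apply: moves_refl. Qed.

(** The choice depends only on the set of pairs reachable from [x], and by
    symmetry and transitivity this set is the same for the whole orbit. *)
Lemma orbit_repr_eq x y : moves x y -> orbit_repr x = orbit_repr y.
Proof.
move=> xy; rewrite /orbit_repr.
have -> : [pick z | moves x z] = [pick z | moves y z].
  apply: eq_pick => z; apply/idP/idP; apply: moves_trans => //.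
  exact: moves_sym.
by case: pickP => // /(_ y); rewrite moves_refl.
Qed.

Definition pair_supp x : {set 'I_n} :=
  [set u | [exists j, (val x.1 j == Some u) || (val x.2 j == Some u)]].

Lemma pair_suppP x u :
  reflect (exists j, val x.1 j = Some u \/ val x.2 j = Some u)
    (u \in pair_supp x).
Proof.
rewrite inE; apply: (iffP existsP) => -[j /=].
  by move=> /orP [/eqP|/eqP] H; exists j; [left|right].
by case=> ju; exists j; rewrite /= ju eqxx ?orbT.
Qed.

Local Notation rk x := #|pair_supp x|.
Local Notation th x := (enum_inj (pair_supp x)).

(** The pair [x] transported from its support to the first [rk x] points, where
    the [rk x]-th cell can act on it. *)
Definition normal_l x := (ISn_inv (th x) * val x.1)%g.
Definition normal_r x := (ISn_inv (th x) * val x.2)%g.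

Lemma pair_supp_l x j u : val x.1 j = Some u -> u \in pair_supp x.
Proof. by move=> ju; apply/pair_suppP; exists j; left. Qed.

Lemma pair_supp_r x j u : val x.2 j = Some u -> u \in pair_supp x.
Proof. by move=> ju; apply/pair_suppP; exists j; right. Qed.

Lemma pdom_normal_l x : pdom (normal_l x) = initial n k.
Proof.
by rewrite pdom_mul_inv_enum_inj ?(eqP (valP x.1)) //; apply: pair_supp_l.
Qed.

Lemma pdom_normal_r x : pdom (normal_r x) = initial n l.
Proof.
by rewrite pdom_mul_inv_enum_inj ?(eqP (valP x.2)) //; apply: pair_supp_r.
Qed.

Lemma normal_lK x : (th x * normal_l x)%g = val x.1.
Proof. by apply: enum_inj_mulVK; apply: pair_supp_l. Qed.

Lemma normal_rK x : (th x * normal_r x)%g = val x.2.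
Proof. by apply: enum_inj_mulVK; apply: pair_supp_r. Qed.

Lemma normal_onto x (i : 'I_n) :
  (i < rk x)%N <-> exists j, normal_l x j = Some i \/ normal_r x j = Some i.
Proof.
have E (s : ISn n) j u : s j = Some u ->
    ((ISn_inv (th x) * s)%g j = Some i <-> th x i = Some u).
  by move=> su; rewrite ISn_mulE su; exact: (ISn_invE (th x) i u).
have -> : (i < rk x)%N = (i \in pdom (th x)) by rewrite pdom_enum_inj inE.
split=> [/pdomP [u iu]|[j [] ji]].
- have /pair_suppP [j [] ju] := enum_inj_in iu; exists j; [left|right];
  exact/(E _ _ _ ju).
- case ju : (val x.1 j) => [u|].
    by move/(E _ _ _ ju)/mem_pdom: ji.
  by move: ji; rewrite /normal_l ISn_mulE ju.
case ju : (val x.2 j) => [u|]; first by move/(E _ _ _ ju)/mem_pdom: ji.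
by move: ji; rewrite /normal_r ISn_mulE ju.
Qed.

Definition orbit_hom x : 'Hom(cell_module K n (rk x), V) :=
  pair_hom K k l (rk x) (normal_l x) (normal_r x).

Lemma orbit_hom_equivariant x : equivariant (orbit_hom x).
Proof.
by apply: pair_hom_equivariant;
  [exact: pdom_normal_l | exact: pdom_normal_r | exact: normal_onto].
Qed.

(** Multiplying the transported pair by the elements of the cell gives distinct
    elements of the orbit, because its two components jointly reach every point
    on which these elements are defined. *)
Lemma card_orbit x : (#|lcell n (rk x)| <= #|moves x|)%N.
Proof.
have onto := normal_onto x.
have dn (t : lcell n (rk x)) :
    (pdom (val t * normal_l x)%g == initial n k) &&
    (pdom (val t * normal_r x)%g == initial n l).
  rewrite -(pdom_mul_initial (pdom_normal_l x) (pdom_normal_r x) onto).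
  by rewrite (eqP (valP t)).
(* The products [val t * normal_l x] and [val t * normal_r x] lie in the cells
   by [dn], so [insubd] never returns its default. *)
pose F (t : lcell n (rk x)) : X :=
  (insubd x.1 (val t * normal_l x)%g, insubd x.2 (val t * normal_r x)%g).
have F1 t : val (F t).1 = (val t * normal_l x)%g.
  by rewrite val_insubd; case/andP: (dn t) => ->.
have F2 t : val (F t).2 = (val t * normal_r x)%g.
  by rewrite val_insubd; case/andP: (dn t) => _ ->.
have Finj : injective F.
  move=> t u tu; apply: val_inj.
  apply: (pair_inj onto (eqP (valP t)) (eqP (valP u))).
    by rewrite -!F1 tu.
  by rewrite -!F2 tu.
rewrite -(card_codom Finj); apply: subset_leq_card.
apply/subsetP => _ /codomP [t ->].
rewrite unfold_in; apply/movesP; exists (val t * ISn_inv (th x))%g.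
  by rewrite F1 -mulgA.
by rewrite F2 -mulgA.
Qed.

Lemma orbit_hom_img x y : moves x y -> pair_vec K y \in limg (orbit_hom x).
Proof.
move=> /movesP [s s1 s2].
have e1 : (s * th x * normal_l x)%g = val y.1 by rewrite -mulgA normal_lK.
have e2 : (s * th x * normal_r x)%g = val y.2 by rewrite -mulgA normal_rK.
have tL : pdom (s * th x)%g == [set i : 'I_n | (i < rk x)%N].
  suff : pdom (s * th x)%g == initial n (rk x) by [].
  rewrite eqEsubset -{1}pdom_enum_inj pdom_mul.
  have onto := normal_onto x.
  rewrite (pdom_mul_initial (pdom_normal_l x) (pdom_normal_r x) onto).
  by rewrite e1 e2 (eqP (valP y.1)) (eqP (valP y.2)) !eqxx.
have -> : pair_vec K y = orbit_hom x (cell_vec K (Sub (s * th x)%g tL)).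
  by rewrite /orbit_hom pair_homE SubK e1 e2 !ISn_vec_val.
by rewrite memv_img ?memvf.
Qed.

(** One map for each orbit: the images contain all basis vectors, and the
    cells together are no larger than the set of all pairs, since each has at
    most as many elements as its orbit. *)
Lemma cell_filtration_tensor : exists F : filtration V, cell_filtration F.
Proof.
pose reprs := [seq x <- enum {: X} | orbit_repr x == x].
have [||F cellF] := filtration_of_sum orbit_hom_equivariant (ts := reprs).
- apply/eqP; rewrite eqEsubv subvf /= -pair_vec_span.
  apply/subv_sumP => y _; rewrite -memvE.
  apply: (@subvP _ _ (limg (orbit_hom (orbit_repr y)))).
    have yr : orbit_repr y \in reprs.
      by rewrite mem_filter mem_enum -(orbit_repr_eq (moves_repr y)) eqxx.
    by rewrite (big_rem _ yr) /= addvSl.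
  exact/orbit_hom_img/moves_sym/moves_repr.
- rewrite dim_tensor_cells -sum1_card big_filter big_enum_cond.
  rewrite [X in (_ <= X)%N](partition_big orbit_repr
    (fun x => orbit_repr x == x)); last first.
    by move=> y _; rewrite -(orbit_repr_eq (moves_repr y)).
  apply: leq_sum => x /eqP rx; rewrite dim_cell_space.
  apply: leq_trans (card_orbit x) _; rewrite sum1_card.
  apply: subset_leq_card; apply/subsetP => y xy.
  by rewrite unfold_in /= -(orbit_repr_eq xy) rx !eqxx.
exists F => i /cellF [x iso]; exists (rk x) => //.
by rewrite -[n in (_ <= n)%N]card_ord max_card.
Qed.

End Orbits.

(** * Multiplicities *)

Section Multiplicity.
Variables (K : fieldType) (n : nat).

(** The rank of [idem n r] is non-zero on the [r]-th cell module and zero on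
    every [s]-th one with [s > r]; compare in both directions. *)
Lemma cell_module_rank_inj r s : (r <= n)%N -> (s <= n)%N ->
  (forall t, (t <= n)%N -> act_rank (cell_module K n r) (idem n t) =
                           act_rank (cell_module K n s) (idem n t)) -> r = s.
Proof.
move=> rn sn H; apply/eqP; rewrite eqn_leq -(ffact_gt0 s) -(ffact_gt0 r).
have := H r rn; have := H s sn; rewrite !act_rank_cell // => -> <-.
by rewrite !ffact_gt0 !leqnn.
Qed.

(** Each subquotient of type [m] contributes [r ^_ m], so the ranks of the
    idempotents are linear in the multiplicities. *)
Lemma act_rank_multiplicity (V : module K (ISn n)) (F : filtration V) r :
  cell_filtration F -> (r <= n)%N ->
  act_rank V (idem n r) =
    (\sum_(m < r.+1) multiplicity F (cell_module K n m) * r ^_ m)%N.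
Proof.
move=> cellF rn.
have /choice [d dE] : forall i : 'I_(flength F), exists m : 'I_n.+1,
    isomorphic (subquotient (F i.+1) (F i)) (cell_module K n m).
  move=> i; have [m mn iso] := cellF i (ltn_ord i).
  by exists (Ordinal (mn : (m < n.+1)%N)).
have dn i : (d i <= n)%N by rewrite -ltnS.
have mult m : (m <= n)%N ->
    multiplicity F (cell_module K n m) = #|[pred i | d i == m :> nat]|.
  move=> mn; apply: eq_card => i; rewrite !inE.
  apply/asboolP/eqP => [iso|<-] //.
  apply: cell_module_rank_inj => // t _.
  by rewrite -(act_rank_iso _ (dE i)) (act_rank_iso _ iso).
rewrite (act_rank_filtration F (idemM n r)).
under eq_bigr => i _ do rewrite (act_rank_iso _ (dE i)) act_rank_cell //.
rewrite (partition_big d predT) //=.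
(* The terms with [r < m] that are added here vanish with [r ^_ m]. *)
rewrite [RHS](big_ord_widen n.+1
  (fun m => multiplicity F (cell_module K n m) * r ^_ m)%N) //.
rewrite [RHS]big_mkcond; apply: eq_bigr => m _ /=.
rewrite (eq_bigr (fun=> r ^_ m)) => [|i /eqP -> //].
have mn : (m <= n)%N by rewrite -ltnS.
rewrite sum_nat_const (mult m mn).
by case: ltnP => // rm; rewrite ffact_small ?muln0.
Qed.

End Multiplicity.

Theorem corollary3 (K : closedFieldType) (charK0 : [pchar K] =i pred0)
    (n k l : nat) (hk : (k <= n)%N) (hl : (l <= n)%N) :
  (exists F : filtration (tensor_module (cell_module K n k) (cell_module K n l)),
     cell_filtration F) /\
  (forall m : nat, (m <= n)%N -> (maxn k l <= m <= k + l)%N ->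
   forall F : filtration (tensor_module (cell_module K n k) (cell_module K n l)),
     cell_filtration F ->
     let b := (k + l - m)%N in
     let a := (k - b)%N in
     let c := (l - b)%N in
     ((multiplicity F (cell_module K n m))%:R : rat) =
       ((a + b)`! * (b + c)`!)%:R / (a`! * b`! * c`!)%:R).
Proof.
split; first exact: cell_filtration_tensor.
move=> m mn klm F cellF b a c; rewrite -(overlapsE klm); congr (_%:R).
apply: (@ffact_coefs_unique
  (fun m => multiplicity F (cell_module K n m)) _ n) => // r rn.
by rewrite -ffact_mul_expand -(act_rank_multiplicity cellF rn) act_rank_tensor.
Qed.
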